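(* Let $\mathcal C$ be a Lawvere theory with a zero object. Then the $\Bbbk$-linear category $\tilde\Phi_{\mathcal C}$ corresponding to the monad $\Phi_{\mathcal C}$ carries a natural structure of a $\Bbbk$-linear PROP, inherited from the product of $\mathcal C$ (on objects it is addition, on morphisms it is $[u_1]\boxtimes[u_2]=[u_1\times u_2]$, and the symmetry is the class of the symmetry of $\mathcal C$). Furthermore, if $\mathcal C$ satisfies (ZM* ), then $\tilde\Phi_{\mathcal C}(n,m)=0$ for all $n,m\in\mathbb N$ with $n<m$.
   Context: $\Bbbk$ is a fixed commutative unital ring; $\mathbb N=\{0,1,2,\dots\}$. Monads. A monad $\mathtt T$ on a set $\mathcal X$ (in the bicategory of matrices of $\Bbbk$-modules) is a family of $\Bbbk$-modules $\mathtt T(Y,X)$ ($X,Y\in\mathcal X$) with associative bilinear composition $\mathtt T(Z,Y)\otimes\mathtt T(Y,X)\to\mathtt T(Z,X)$, $(g,f)\mapsto g\circ f$, and units $1_X\in\mathtt T(X,X)$. It is the same as a $\Bbbk$-linear category $\tilde{\mathtt T}$ with object set $\mathcal X$ and $\tilde{\mathtt T}(X,Y)=\mathtt T(Y,X)$. A left ideal $\mathtt J\subset\mathtt T$ is a family of submodules $\mathtt J(Y,X)\subset\mathtt T(Y,X)$ with $\mathtt T\circ\mathtt J\subset\mathtt J$. Its idealizer is the submonad $\mathrm{Iz}(\mathtt J)(Y,X)=\{f\in\mathtt T(Y,X): \mathtt J(Z,Y)\circ f\subset\mathtt J(Z,X)\ \forall Z\}$, which contains $\mathtt J$ as a two-sided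 ideal; the eigenmonad is $\mathrm E_{\mathtt T}(\mathtt J)=\mathrm{Iz}(\mathtt J)/\mathtt J$. Lawvere theories. A Lawvere theory is a category $\mathcal C$ with finite products, with object set $\mathbb N$, the product on objects being addition. $\mathtt L_{\mathcal C}$ is the monad on $\mathbb N$ with $\mathtt L_{\mathcal C}(m,n)=\Bbbk[\mathcal C(n,m)]$ and the composition of $\mathcal C$; the product of morphisms is extended bilinearly. Let $\mathcal C$ have a zero object (it is $0$), $\Delta\in\mathcal C(1,2)$ the diagonal, $\eta\in\mathcal C(0,1)$ the zero morphism. For $n\ge1$, $1\le k\le n$ put $$\bar\Delta^{n,k}=\mathrm{id}_{k-1}\times\Delta\times\mathrm{id}_{n-k}-\mathrm{id}_k\times\eta\times\mathrm{id}_{n-k}-\mathrm{id}_{k-1}\times\eta\times\mathrm{id}_{n-k+1}\in\mathtt L_{\mathcal C}(n+1,n).$$ The primitivity ideal $\mathtt I^{\mathsf{pr}}_{\mathcal C}$ is the left ideal of $\mathtt L_{\mathcal C}$ generated by all $\bar\Delta^{n,k}$, and $\Phi_{\mathcal C}=\mathrm E_{\mathtt L_{\mathcal C}}(\mathtt I^{\mathsf{pr}}_{\mathcal C})$; $[u]$ denotes the class of $u\in\mathrm{Iz}(\mathtt I^{\mathsf{pr}}_{\mathcal C})$. A $\Bbbk$-linear PROP is a $\Bbbk$-linear permutative (strict symmetric monoidal) category with object set $\mathbb N$ whose monoidal structure on objects is addition. Condition (ZM* ). Write $\mathcal C_n=\mathcal C(n,1)$ and $p_{n,k}\in\mathcal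 C(n,1)$ for the $k$-th projection. (ZM* ) means: (Z) $\mathcal C$ has a zero object; (M) the object $1$ is equipped with a specified monoid object structure in $(\mathcal C,\times)$, so each $\mathcal C_n$ is a monoid naturally in $n$; (M* ) for each $n$ the monoid $\mathcal C_n$ is generated by $\bigcup_{k=1}^n\{f\circ p_{n,k}: f\in\mathcal C_1\}$. *)

(* Defs.v *)
(* The classical axioms of boolp only serve to turn Prop-valued submodules into
   boolean predicates, as [submodClosed] and quotients require. *)
From HB Require Import structures.
From mathcomp Require Import all_boot all_algebra ring_quotient finmap.
From mathcomp Require Import boolp monalg.

Set Implicit Arguments.
Unset Strict Implicit.
Unset Printing Implicit Defensive.

Import GRing.Theory.
Local Open Scope ring_scope.

Section Subquotient.
Variables (R : pzRingType) (V : lmodType R) (S N : submodClosed V).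

Record subm := Subm { subm_val : V; _ : subm_val \in S }.
HB.instance Definition _ := [isSub for subm_val].
HB.instance Definition _ := [Choice of subm by <:].
HB.instance Definition _ := [SubChoice_isSubLmodule of subm by <:].

Definition subm_pred : {pred subm} := [pred v | val v \in N].

Fact subm_pred_closed : submod_closed subm_pred.
Proof.
split=> [|a u v]; first by rewrite inE raddf0 rpred0.
by rewrite !inE linearP => Nu Nv; rewrite rpredD ?rpredZ.
Qed.

HB.instance Definition _ := GRing.isSubmodClosed.Build R subm subm_pred
  subm_pred_closed.

(* The module S / (S :&: N), which is S / N when N is contained in S. *)
Definition subquot : Type :=
  Quotient.quot (GRing.ZmodClosed.clone subm subm_pred _).

HB.instance Definition _ := GRing.Zmodule.on subquot.

Definition subquot_class (v : V) (Sv : v \in S) : subquot :=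
  \pi_(Quotient.quot (GRing.ZmodClosed.clone subm subm_pred _))%qT (Subm Sv).

Definition subquot_repr (x : subquot) : V := subm_val (repr x).

Lemma subquot_reprP x : subquot_repr x \in S.
Proof. exact: (valP (repr x)). Qed.

Lemma subquot_classP u v (Su : u \in S) (Sv : v \in S) :
  subquot_class Su = subquot_class Sv <-> u - v \in N.
Proof.
have -> : (u - v \in N) = (Subm Su - Subm Sv \in subm_pred).
  by rewrite [RHS]inE raddfB.
rewrite (@Quotient.idealrBE _ (GRing.ZmodClosed.clone subm subm_pred _)).
by split=> [/eqP|/eqP].
Qed.

Lemma subquot_reprK x : subquot_class (subquot_reprP x) = x.
Proof.
rewrite -[RHS]reprK /subquot_class; congr (\pi_ _ _)%qT.
exact: val_inj.
Qed.

Lemma subquot_classK u (Su : u \in S) :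
  subquot_repr (subquot_class Su) - u \in N.
Proof. by apply/(subquot_classP (subquot_reprP _)); rewrite subquot_reprK. Qed.

Lemma subquot_classD u v (Su : u \in S) (Sv : v \in S) (Suv : u + v \in S) :
  subquot_class Suv = subquot_class Su + subquot_class Sv.
Proof.
rewrite /subquot_class -[RHS]raddfD; congr (\pi_ _ _)%qT.
exact: val_inj.
Qed.

Definition subquot_scale (a : R) (x : subquot) : subquot :=
  subquot_class (rpredZ a (subquot_reprP x)).

Lemma subquot_classZ a u (Su : u \in S) (Sau : a *: u \in S) :
  subquot_class Sau = subquot_scale a (subquot_class Su).
Proof.
apply/subquot_classP; rewrite -scalerBr -[_ - _]opprB scalerN -scaleNr.
by rewrite rpredZ ?subquot_classK.
Qed.

Lemma subquot_ind (P : subquot -> Prop) :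
  (forall u (Su : u \in S), P (subquot_class Su)) -> forall x, P x.
Proof. by move=> PS x; rewrite -[x]subquot_reprK; apply: PS. Qed.

Lemma eq_subquot_class u v (Su : u \in S) (Sv : v \in S) :
  u = v -> subquot_class Su = subquot_class Sv.
Proof. by move=> uv; apply/subquot_classP; rewrite uv subrr rpred0. Qed.

Fact subquot_scaleA a b x :
  subquot_scale a (subquot_scale b x) = subquot_scale (a * b) x.
Proof.
elim/subquot_ind: x => u Su; have Sbu := rpredZ b Su.
rewrite -(subquot_classZ Su Sbu) -(subquot_classZ Sbu (rpredZ a Sbu)).
rewrite -(subquot_classZ Su (rpredZ (a * b) Su)).
by apply: eq_subquot_class; rewrite scalerA.
Qed.

Fact subquot_scale1 : left_id 1 subquot_scale.
Proof.
elim/subquot_ind => u Su; rewrite -(subquot_classZ Su (rpredZ 1 Su)).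
by apply: eq_subquot_class; rewrite scale1r.
Qed.

Fact subquot_scaleDr : right_distributive subquot_scale +%R.
Proof.
move=> a; elim/subquot_ind=> u Su; elim/subquot_ind=> v Sv.
have Suv := rpredD Su Sv; rewrite -(subquot_classD Su Sv Suv).
rewrite -(subquot_classZ _ (rpredZ a Suv)).
have [Sau Sav] := (rpredZ a Su, rpredZ a Sv).
rewrite -(subquot_classZ _ Sau) -(subquot_classZ _ Sav).
rewrite -(subquot_classD Sau Sav (rpredD Sau Sav)).
by apply: eq_subquot_class; rewrite scalerDr.
Qed.

Fact subquot_scaleDl x : {morph subquot_scale^~ x : a b / a + b}.
Proof.
move=> a b; elim/subquot_ind: x => u Su.
have [Sau Sbu] := (rpredZ a Su, rpredZ b Su).
rewrite -(subquot_classZ _ (rpredZ (a + b) Su)).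
rewrite -(subquot_classZ _ Sau) -(subquot_classZ _ Sbu).
rewrite -(subquot_classD Sau Sbu (rpredD Sau Sbu)).
by apply: eq_subquot_class; rewrite scalerDl.
Qed.

HB.instance Definition _ := GRing.Zmodule_isLmodule.Build R subquot
  subquot_scaleA subquot_scale1 subquot_scaleDr subquot_scaleDl.

Lemma subquot_classL a u v (Su : u \in S) (Sv : v \in S)
    (Sauv : a *: u + v \in S) :
  subquot_class Sauv = a *: subquot_class Su + subquot_class Sv.
Proof.
have Sau := rpredZ a Su.
by rewrite (subquot_classD Sau Sv) (subquot_classZ Su).
Qed.
End Subquotient.

(* [malg] has a module structure over nontrivial rings only; this one is
   over an arbitrary ring. *)
Definition freemod (R : pzRingType) (G : choiceType) : Type := {malg R[G]}.

Section FreeModule.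
Variables (R : pzRingType) (G : choiceType).

HB.instance Definition _ := GRing.Zmodule.on (freemod R G).

Definition fm_scale (a : R) (u : freemod R G) : freemod R G :=
  \sum_(g <- msupp u) << a * u@_g *g g >>.

Fact fm_scaleE a u g : (fm_scale a u)@_g = a * u@_g.
Proof.
rewrite {2}[u]monalgE !raddf_sum mulr_sumr.
by apply: eq_bigr => h _ /=; rewrite !mcoeffU mulrnAr.
Qed.

Fact fm_scaleA a b u : fm_scale a (fm_scale b u) = fm_scale (a * b) u.
Proof. by apply/malgP=> g; rewrite !fm_scaleE mulrA. Qed.

Fact fm_scale1 : left_id 1 fm_scale.
Proof. by move=> u; apply/malgP=> g; rewrite !fm_scaleE mul1r. Qed.

Fact fm_scaleDr : right_distributive fm_scale +%R.
Proof.
move=> a u v; apply/malgP=> g.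
by rewrite mcoeffD !fm_scaleE mcoeffD mulrDr.
Qed.

Fact fm_scaleDl u : {morph fm_scale^~ u : a b / a + b}.
Proof. by move=> a b; apply/malgP=> g; rewrite mcoeffD !fm_scaleE mulrDl. Qed.

HB.instance Definition _ := GRing.Zmodule_isLmodule.Build R (freemod R G)
  fm_scaleA fm_scale1 fm_scaleDr fm_scaleDl.

Definition fm_basis (g : G) : freemod R G := << 1 *g g >>.

Lemma fm_coeffP (a : R) (u v : freemod R G) g :
  (a *: u + v)@_g = a * u@_g + v@_g.
Proof. by rewrite mcoeffD fm_scaleE. Qed.

Lemma fm_basisZ a g : a *: fm_basis g = << a *g g >>.
Proof.
by apply/malgP=> h; rewrite fm_scaleE !mcoeffU mulrnAr mulr1.
Qed.

Lemma fm_decomp (u : freemod R G) :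
  u = \sum_(g <- msupp u) u@_g *: fm_basis g.
Proof.
by rewrite {1}[u]monalgE; apply: eq_bigr => g _; rewrite fm_basisZ.
Qed.

Variable V : lmodType R.

Definition fm_lift (f : G -> V) (u : freemod R G) : V :=
  \sum_(g <- msupp u) u@_g *: f g.

Lemma fm_liftw f (u : freemod R G) (d : {fset G}) : (msupp u `<=` d)%fset ->
  fm_lift f u = \sum_(g <- d) u@_g *: f g.
Proof.
move=> sud; rewrite /fm_lift (big_fset_incl _ sud) //= => g _.
by move/mcoeff_outdom->; rewrite scale0r.
Qed.

Lemma fm_liftP f : linear (fm_lift f).
Proof.
move=> a u v.
set d := (msupp u `|` msupp v `|` msupp (a *: u + v)%R)%fset.
rewrite !(@fm_liftw _ _ d).
- rewrite scaler_sumr -big_split /=; apply: eq_bigr => g _.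
  by rewrite fm_coeffP scalerDl scalerA.
- by rewrite /d -fsetUA fsubsetU // fsubsetUl orbT.
- by rewrite /d -fsetUA fsubsetUl.
- by rewrite fsubsetUr.
Qed.

HB.instance Definition _ f :=
  GRing.isLinear.Build R (freemod R G) V *:%R (fm_lift f) (fm_liftP f).

Lemma fm_liftE f g : fm_lift f (fm_basis g) = f g.
Proof.
rewrite (@fm_liftw _ _ [fset g]%fset) ?msuppU_le //.
by rewrite big_seq_fset1 mcoeffUU scale1r.
Qed.

Lemma fm_ext (f f' : freemod R G -> V) : linear f -> linear f' ->
  (forall g, f (fm_basis g) = f' (fm_basis g)) -> f =1 f'.
Proof.
move=> lf lf' ff'.
have h (k : freemod R G -> V) : linear k ->
    {K : {linear freemod R G -> V} | K =1 k}.
  move=> lk; pose K := GRing.isLinear.Build R _ V *:%R k lk.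
  by exists (HB.pack_for {linear freemod R G -> V} k K).
have [K EK] := h _ lf; have [K' EK'] := h _ lf'.
move=> u; rewrite -EK -EK' [u]fm_decomp !linear_sum; apply: eq_bigr => g _.
by rewrite !linearZ EK EK' ff'.
Qed.
End FreeModule.

(* [T Y X] consists of the elements from X to Y. *)
Record monad (R : pzRingType) (X : Type) := Monad {
  mhom :> X -> X -> lmodType R;
  mcomp : forall Z Y X, mhom Z Y -> mhom Y X -> mhom Z X;
  munit : forall X, mhom X X;
  mcompDl : forall Z Y X (f : mhom Y X), linear (fun g : mhom Z Y => mcomp g f);
  mcompDr : forall Z Y X (g : mhom Z Y), linear (fun f : mhom Y X => mcomp g f);
  mcompA : forall W Z Y X (h : mhom W Z) (g : mhom Z Y) (f : mhom Y X),
    mcomp h (mcomp g f) = mcomp (mcomp h g) f;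
  mcomp1l : forall Y X (f : mhom Y X), mcomp (munit Y) f = f;
  mcomp1r : forall Y X (f : mhom Y X), mcomp f (munit X) = f
}.
Arguments munit {R X} m _.

Record lincat (R : pzRingType) (X : Type) := LinCat {
  khom :> X -> X -> lmodType R;
  kcomp : forall X Y Z, khom Y Z -> khom X Y -> khom X Z;
  kid : forall X, khom X X;
  kcompDl : forall X Y Z (f : khom X Y), linear (fun g : khom Y Z => kcomp g f);
  kcompDr : forall X Y Z (g : khom Y Z), linear (fun f : khom X Y => kcomp g f);
  kcompA : forall W X Y Z (h : khom Y Z) (g : khom X Y) (f : khom W X),
    kcomp h (kcomp g f) = kcomp (kcomp h g) f;
  kcomp1l : forall X Y (f : khom X Y), kcomp (kid Y) f = f;
  kcomp1r : forall X Y (f : khom X Y), kcomp f (kid X) = f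
}.
Arguments kid {R X} l _.

Definition monad_cat (R : pzRingType) (X : Type) (T : monad R X) : lincat R X :=
  @LinCat R X (fun x y => T y x) (fun x y z g f => mcomp g f) (munit T)
    (fun x y z f => mcompDl f) (fun x y z g => mcompDr g)
    (fun w x y z h g f => mcompA h g f)
    (fun x y f => mcomp1l f) (fun x y f => mcomp1r f).

Record left_ideal (R : pzRingType) (X : Type) (T : monad R X) := LeftIdeal {
  lideal :> forall Y X, submodClosed (T Y X);
  lidealM : forall Z Y X (g : T Z Y) (f : T Y X),
    f \in lideal Y X -> mcomp g f \in lideal Z X
}.

Section Ideals.
Variables (R : pzRingType) (X : Type) (T : monad R X).

Lemma mcompBl Z Y W (g g' : T Z Y) (f : T Y W) :
  mcomp (g - g') f = mcomp g f - mcomp g' f.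
Proof. by rewrite -scaleN1r addrC mcompDl scaleN1r addrC. Qed.

Lemma mcompBr Z Y W (g : T Z Y) (f f' : T Y W) :
  mcomp g (f - f') = mcomp g f - mcomp g f'.
Proof. by rewrite -scaleN1r addrC mcompDr scaleN1r addrC. Qed.

Lemma mcomp0l Z Y W (f : T Y W) : mcomp (0 : T Z Y) f = 0.
Proof. by rewrite -(subrr 0) mcompBl subrr. Qed.

Lemma mcomp0r Z Y W (g : T Z Y) : mcomp g (0 : T Y W) = 0.
Proof. by rewrite -(subrr 0) mcompBr subrr. Qed.

Section Generated.
Variable G : forall Y X, T Y X -> Prop.

Definition gen_pred Y W : {pred T Y W} := [pred u | `[<
  forall J : left_ideal T,
    (forall Y' W' (v : T Y' W'), G v -> v \in J Y' W') -> u \in J Y W >]].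

Fact gen_pred_closed Y W : submod_closed (@gen_pred Y W).
Proof.
split=> [|a u v]; first by apply/asboolP => J _; rewrite rpred0.
move=> /asboolP Gu /asboolP Gv; apply/asboolP => J GJ.
by rewrite rpredD ?rpredZ ?Gu ?Gv.
Qed.

HB.instance Definition _ Y W := GRing.isSubmodClosed.Build R (T Y W)
  (@gen_pred Y W) (@gen_pred_closed Y W).

Fact gen_predM Z Y W (g : T Z Y) (f : T Y W) :
  f \in @gen_pred Y W -> mcomp g f \in @gen_pred Z W.
Proof. by move=> /asboolP Gf; apply/asboolP=> J GJ; apply/lidealM/Gf. Qed.

Definition gen_left_ideal : left_ideal T :=
  @LeftIdeal R X T (fun Y W => @gen_pred Y W) gen_predM.
End Generated.

Variable J : left_ideal T.

Definition idealizer_pred Y W : {pred T Y W} := [pred f | `[<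
  forall Z (g : T Z Y), g \in J Z Y -> mcomp g f \in J Z W >]].

Fact idealizer_pred_closed Y W : submod_closed (@idealizer_pred Y W).
Proof.
split=> [|a u v]; first by apply/asboolP => Z g _; rewrite mcomp0r rpred0.
move=> /asboolP Iu /asboolP Iv; apply/asboolP => Z g Jg.
by rewrite mcompDr rpredD ?rpredZ ?Iu ?Iv.
Qed.

HB.instance Definition _ Y W := GRing.isSubmodClosed.Build R (T Y W)
  (@idealizer_pred Y W) (@idealizer_pred_closed Y W).

Definition idealizer Y W : submodClosed (T Y W) := @idealizer_pred Y W.

Lemma idealizerP Y W (f : T Y W) :
  f \in idealizer Y W <->
  (forall Z (g : T Z Y), g \in J Z Y -> mcomp g f \in J Z W).
Proof. by split=> [/asboolP|] // ?; apply/asboolP. Qed.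

Lemma idealizer_unit Y : munit T Y \in idealizer Y Y.
Proof. by apply/idealizerP => Z g Jg; rewrite mcomp1r. Qed.

Lemma idealizerM Z Y W (g : T Z Y) (f : T Y W) :
  g \in idealizer Z Y -> f \in idealizer Y W -> mcomp g f \in idealizer Z W.
Proof.
move=> /idealizerP Ig /idealizerP If; apply/idealizerP => V h Jh.
by rewrite mcompA If ?Ig.
Qed.

Lemma left_ideal_idealizer Y W (f : T Y W) :
  f \in J Y W -> f \in idealizer Y W.
Proof. by move=> Jf; apply/idealizerP => Z g _; apply: lidealM. Qed.

Definition eigen_hom Y W : lmodType R := subquot (idealizer Y W) (J Y W).

Definition eigen_class Y W (u : T Y W) (Iu : u \in idealizer Y W) :
  eigen_hom Y W := subquot_class (J Y W) Iu.

Definition eigen_comp Z Y W (g : eigen_hom Z Y) (f : eigen_hom Y W) :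
    eigen_hom Z W :=
  eigen_class (idealizerM (subquot_reprP g) (subquot_reprP f)).

Lemma eigen_compE Z Y W (g : T Z Y) (f : T Y W) (Ig : g \in idealizer Z Y)
    (If : f \in idealizer Y W) :
  eigen_comp (eigen_class Ig) (eigen_class If)
    = eigen_class (idealizerM Ig If).
Proof.
apply/subquot_classP.
set g' := subquot_repr _; set f' := subquot_repr _.
have -> : mcomp g' f' - mcomp g f = mcomp (g' - g) f' + mcomp g (f' - f).
  by rewrite mcompBl mcompBr addrA subrK.
rewrite rpredD //; last by apply: lidealM; apply: subquot_classK.
by have /idealizerP If' := subquot_reprP (eigen_class If); apply: If';
  apply: subquot_classK.
Qed.

Lemma eigen_classP Y W (u v : T Y W) (Iu : u \in idealizer Y W)
    (Iv : v \in idealizer Y W) :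
  eigen_class Iu = eigen_class Iv <-> u - v \in J Y W.
Proof. exact: subquot_classP. Qed.

Lemma eigen_class_eq Y W (u v : T Y W) (Iu : u \in idealizer Y W)
    (Iv : v \in idealizer Y W) : u = v -> eigen_class Iu = eigen_class Iv.
Proof. exact: eq_subquot_class. Qed.

Lemma eigen_ind Y W (P : eigen_hom Y W -> Prop) :
  (forall u (Iu : u \in idealizer Y W), P (eigen_class Iu)) -> forall x, P x.
Proof. exact: subquot_ind. Qed.

Lemma eigen_classL Y W a (u v : T Y W) (Iu : u \in idealizer Y W)
    (Iv : v \in idealizer Y W) (Iauv : a *: u + v \in idealizer Y W) :
  eigen_class Iauv = a *: eigen_class Iu + eigen_class Iv.
Proof. exact: subquot_classL. Qed.

Fact eigen_compDl Z Y W (f : eigen_hom Y W) :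
  linear (fun g : eigen_hom Z Y => eigen_comp g f).
Proof.
move=> a; elim/eigen_ind=> u Iu; elim/eigen_ind=> v Iv.
elim/eigen_ind: f => f If; have Iauv := rpredD (rpredZ a Iu) Iv.
rewrite -(eigen_classL Iu Iv Iauv) !eigen_compE.
rewrite -(eigen_classL _ _ (rpredD (rpredZ a (idealizerM Iu If)) (idealizerM Iv If))).
by apply: eigen_class_eq; rewrite mcompDl.
Qed.

Fact eigen_compDr Z Y W (g : eigen_hom Z Y) :
  linear (fun f : eigen_hom Y W => eigen_comp g f).
Proof.
move=> a; elim/eigen_ind=> u Iu; elim/eigen_ind=> v Iv.
elim/eigen_ind: g => g Ig; have Iauv := rpredD (rpredZ a Iu) Iv.
rewrite -(eigen_classL Iu Iv Iauv) !eigen_compE.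
rewrite -(eigen_classL _ _ (rpredD (rpredZ a (idealizerM Ig Iu)) (idealizerM Ig Iv))).
by apply: eigen_class_eq; rewrite mcompDr.
Qed.

Fact eigen_compA V Z Y W (h : eigen_hom V Z) (g : eigen_hom Z Y)
    (f : eigen_hom Y W) :
  eigen_comp h (eigen_comp g f) = eigen_comp (eigen_comp h g) f.
Proof.
elim/eigen_ind: h => h Ih; elim/eigen_ind: g => g Ig; elim/eigen_ind: f => f If.
by rewrite !eigen_compE; apply: eigen_class_eq; rewrite mcompA.
Qed.

Fact eigen_comp1l Y W (f : eigen_hom Y W) :
  eigen_comp (eigen_class (idealizer_unit Y)) f = f.
Proof.
elim/eigen_ind: f => f If; rewrite eigen_compE.
by apply: eigen_class_eq; rewrite mcomp1l.
Qed.

Fact eigen_comp1r Y W (f : eigen_hom Y W) :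
  eigen_comp f (eigen_class (idealizer_unit W)) = f.
Proof.
elim/eigen_ind: f => f If; rewrite eigen_compE.
by apply: eigen_class_eq; rewrite mcomp1r.
Qed.

Definition eigenmonad : monad R X :=
  @Monad R X eigen_hom eigen_comp (fun Y => eigen_class (idealizer_unit Y))
    eigen_compDl eigen_compDr eigen_compA eigen_comp1l eigen_comp1r.
End Ideals.

(* Transport along equalities of objects; it does not depend on the proofs of
   these equalities. *)
Definition kcast (R : pzRingType) (A : lincat R nat) m m' n n' (em : m = m')
    (en : n = n') (f : A m n) : A m' n' :=
  match em in _ = m1, en in _ = n1 return A m1 n1 with
  | erefl, erefl => f
  end.

(* A strict symmetric monoidal structure which is addition on objects.  As
   [0 + n] computes to [n], left unitality needs no [kcast]. *)
Record prop_structure (R : pzRingType) (A : lincat R nat) := PropStructure {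
  ptens : forall m1 n1 m2 n2, A m1 n1 -> A m2 n2 -> A (m1 + m2)%N (n1 + n2)%N;
  psym : forall m n, A (m + n)%N (n + m)%N;
  ptensDl : forall m1 n1 m2 n2 (g : A m2 n2),
    linear (fun f : A m1 n1 => ptens f g);
  ptensDr : forall m1 n1 m2 n2 (f : A m1 n1),
    linear (fun g : A m2 n2 => ptens f g);
  ptens_id : forall m n, ptens (kid A m) (kid A n) = kid A (m + n)%N;
  ptens_comp : forall l1 m1 n1 l2 m2 n2 (g1 : A m1 n1) (f1 : A l1 m1)
      (g2 : A m2 n2) (f2 : A l2 m2),
    ptens (kcomp g1 f1) (kcomp g2 f2) = kcomp (ptens g1 g2) (ptens f1 f2);
  ptensA : forall m1 n1 m2 n2 m3 n3
      (f : A m1 n1) (g : A m2 n2) (h : A m3 n3),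
    kcast (addnA m1 m2 m3) (addnA n1 n2 n3) (ptens f (ptens g h))
      = ptens (ptens f g) h;
  ptens0l : forall m n (f : A m n), ptens (kid A 0%N) f = f;
  ptens0r : forall m n (f : A m n),
    kcast (addn0 m) (addn0 n) (ptens f (kid A 0%N)) = f;
  psym_nat : forall m1 n1 m2 n2 (f : A m1 n1) (g : A m2 n2),
    kcomp (psym n1 n2) (ptens f g) = kcomp (ptens g f) (psym m1 m2);
  psymK : forall m n, kcomp (psym n m) (psym m n) = kid A (m + n)%N;
  psym0 : forall n, kcast (addn0 n) (erefl n) (psym n 0%N) = kid A n;
  psym_hexagon : forall l m n,
    kcast (addnA l m n) (esym (addnA m n l)) (psym l (m + n)%N)
      = kcomp (ptens (kid A m) (psym l n))
          (kcast (erefl (l + m + n)%N) (esym (addnA m l n))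
             (ptens (psym l m) (kid A n)))
}.

(* Every object [n] is the [n]-th power of [1], with specified projections; then
   [m + n] is a product of [m] and [n] (see [lpi1_pair], [lpi2_pair] and
   [lpair_uniq]), and these binary products are strictly associative. *)
Record lawvere := Lawvere {
  lhom :> nat -> nat -> choiceType;
  lcomp : forall l m n, lhom m n -> lhom l m -> lhom l n;
  lid : forall n, lhom n n;
  lcompA : forall k l m n (h : lhom m n) (g : lhom l m) (f : lhom k l),
    lcomp h (lcomp g f) = lcomp (lcomp h g) f;
  lcomp1l : forall m n (f : lhom m n), lcomp (lid n) f = f;
  lcomp1r : forall m n (f : lhom m n), lcomp f (lid m) = f;
  lproj : forall n, 'I_n -> lhom n 1%N;
  ltuple : forall m n, ('I_n -> lhom m 1%N) -> lhom m n;
  lproj_tuple : forall m n (f : 'I_n -> lhom m 1%N) k,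
    lcomp (lproj k) (ltuple f) = f k;
  ltuple_uniq : forall m n (f : 'I_n -> lhom m 1%N) (g : lhom m n),
    (forall k, lcomp (lproj k) g = f k) -> g = ltuple f;
  lproj1 : lproj (ord0 : 'I_1) = lid 1%N
}.
Arguments lid C n : rename, clear implicits.
Arguments lproj C {n} k : rename.

Definition lcast (C : lawvere) m m' n n' (em : m = m') (en : n = n')
    (f : C m n) : C m' n' :=
  match em in _ = m1, en in _ = n1 return C m1 n1 with
  | erefl, erefl => f
  end.

Section LawvereProducts.
Variable C : lawvere.

Definition lpi1 m n : C (m + n)%N m := ltuple (fun i => lproj C (lshift n i)).
Definition lpi2 m n : C (m + n)%N n := ltuple (fun i => lproj C (rshift m i)).

Definition lpair l m n (f : C l m) (g : C l n) : C l (m + n)%N :=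
  ltuple (fun k => match split k with
                   | inl i => lcomp (lproj C i) f
                   | inr j => lcomp (lproj C j) g
                   end).

Lemma lhom_ext m n (f g : C m n) :
  (forall k, lcomp (lproj C k) f = lcomp (lproj C k) g) -> f = g.
Proof. by move=> fg; rewrite (ltuple_uniq fg); symmetry; apply: ltuple_uniq. Qed.

Lemma lpi1_pair l m n (f : C l m) (g : C l n) :
  lcomp (lpi1 m n) (lpair f g) = f.
Proof.
apply: lhom_ext => k; rewrite lcompA !lproj_tuple.
by case: split_ordP => j /eqP; rewrite eq_shift // => /eqP ->.
Qed.

Lemma lpi2_pair l m n (f : C l m) (g : C l n) :
  lcomp (lpi2 m n) (lpair f g) = g.
Proof.
apply: lhom_ext => k; rewrite lcompA !lproj_tuple.
by case: split_ordP => j /eqP; rewrite eq_shift // => /eqP ->.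
Qed.

Lemma lpair_uniq l m n (f : C l m) (g : C l n) (h : C l (m + n)%N) :
  lcomp (lpi1 m n) h = f -> lcomp (lpi2 m n) h = g -> h = lpair f g.
Proof.
move=> <- <-; apply: ltuple_uniq => k.
by case: split_ordP => j ->; rewrite lcompA lproj_tuple.
Qed.

Lemma lterm_uniq n (f g : C n 0%N) : f = g.
Proof. by apply: lhom_ext; case. Qed.

Definition lprod m1 n1 m2 n2 (f : C m1 n1) (g : C m2 n2) :
    C (m1 + m2)%N (n1 + n2)%N :=
  lpair (lcomp f (lpi1 m1 m2)) (lcomp g (lpi2 m1 m2)).

Definition lsym m n : C (m + n)%N (n + m)%N := lpair (lpi2 m n) (lpi1 m n).

Definition ldiag : C 1%N 2%N := lpair (lid C 1) (lid C 1).

Definition lterm n : C n 0%N := lpi1 0 n.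
End LawvereProducts.

(* The terminal object [0] is initial. *)
Record zero_object (C : lawvere) := ZeroObject {
  lzero : forall n, C 0%N n;
  lzero_uniq : forall n (f : C 0%N n), f = lzero n
}.

(* The sources and targets below are equal by computation: [2 + 1] and [1 + 2]
   are [3], and [0 + 1] and [1 + 0] are [1]. *)
Record monoid_object (C : lawvere) := MonoidObject {
  mo_mul : C 2%N 1%N;
  mo_one : C 0%N 1%N;
  mo_mulA : lcomp mo_mul (lprod mo_mul (lid C 1) : C 3%N 2%N)
              = lcomp mo_mul (lprod (lid C 1) mo_mul : C 3%N 2%N);
  mo_mul1l : lcomp mo_mul (lprod mo_one (lid C 1) : C 1%N 2%N) = lid C 1;
  mo_mul1r : lcomp mo_mul (lprod (lid C 1) mo_one : C 1%N 2%N) = lid C 1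
}.

Inductive generated_submonoid (T : Type) (mul : T -> T -> T) (one : T)
    (G : T -> Prop) : T -> Prop :=
| GenIn x : G x -> generated_submonoid mul one G x
| GenOne : generated_submonoid mul one G one
| GenMul x y : generated_submonoid mul one G x ->
    generated_submonoid mul one G y -> generated_submonoid mul one G (mul x y).

Section ConditionZM.
Variables (C : lawvere) (M : monoid_object C).

Definition hom_mul n (f g : C n 1%N) : C n 1%N :=
  lcomp (mo_mul M) (lpair f g : C n 2%N).

Definition hom_one n : C n 1%N := lcomp (mo_one M) (lterm C n).

Definition monoid_generated := forall n (h : C n 1%N),
  generated_submonoid (@hom_mul n) (hom_one n)
    (fun h => exists (k : 'I_n) (f : C 1%N 1%N), h = lcomp f (lproj C k)) h.
End ConditionZM.

Section BilinearExtension.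
Variables (R : comPzRingType) (G H K : choiceType) (op : G -> H -> K).

Definition fm_bilin (u : freemod R G) (v : freemod R H) : freemod R K :=
  fm_lift (fun g => fm_lift (fun h => fm_basis R (op g h)) v) u.

Fact fm_bilinDl v : linear (fun u => fm_bilin u v).
Proof. exact: linearP. Qed.

Fact fm_bilinDr u : linear (fm_bilin u).
Proof.
move=> a v w; rewrite /fm_bilin /fm_lift scaler_sumr -big_split /=.
apply: eq_bigr => g _; rewrite -!/(fm_lift _ _) linearP.
by rewrite scalerDr !scalerA mulrC.
Qed.

Lemma fm_bilinE g h :
  fm_bilin (fm_basis R g) (fm_basis R h) = fm_basis R (op g h).
Proof. by rewrite /fm_bilin !fm_liftE. Qed.
End BilinearExtension.

Section Linearization.
Variables (R : comPzRingType) (C : lawvere).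

(* Indices are (target, source) here but (source, target) in [C]. *)
Definition lin_hom m n : lmodType R := freemod R (C n m).

Definition lin_comp l m n (g : lin_hom l m) (f : lin_hom m n) : lin_hom l n :=
  fm_bilin (fun g f => lcomp g f) g f.

Fact lin_compDl l m n (f : lin_hom m n) :
  linear (fun g : lin_hom l m => lin_comp g f).
Proof. exact: fm_bilinDl. Qed.

Fact lin_compDr l m n (g : lin_hom l m) :
  linear (fun f : lin_hom m n => lin_comp g f).
Proof. exact: fm_bilinDr. Qed.

Fact lin_compA k l m n (h : lin_hom k l) (g : lin_hom l m) (f : lin_hom m n) :
  lin_comp h (lin_comp g f) = lin_comp (lin_comp h g) f.
Proof.
move: h; apply: fm_ext => [|a u v|h]; first exact: lin_compDl.
  by rewrite !lin_compDl.
move: g; apply: fm_ext => [a u v|a u v|g].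
- by rewrite lin_compDl lin_compDr.
- by rewrite lin_compDr lin_compDl.
move: f; apply: fm_ext => [a u v|a u v|f].
- by rewrite !lin_compDr.
- by rewrite !lin_compDr.
by rewrite /lin_comp !fm_bilinE lcompA.
Qed.

Fact lin_comp1l m n (f : lin_hom m n) :
  lin_comp (fm_basis R (lid C m)) f = f.
Proof.
move: f; apply: fm_ext => [|//|f]; first exact: lin_compDr.
by rewrite /lin_comp fm_bilinE lcomp1l.
Qed.

Fact lin_comp1r m n (f : lin_hom m n) :
  lin_comp f (fm_basis R (lid C n)) = f.
Proof.
move: f; apply: fm_ext => [|//|f]; first exact: lin_compDl.
by rewrite /lin_comp fm_bilinE lcomp1r.
Qed.

Definition lin_monad : monad R nat :=
  @Monad R nat lin_hom lin_comp (fun n => fm_basis R (lid C n))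
    lin_compDl lin_compDr lin_compA lin_comp1l lin_comp1r.

Definition lin_of m n (f : C n m) : lin_monad m n := fm_basis R f.

Definition lin_prod m1 n1 m2 n2 (u1 : lin_monad m1 n1) (u2 : lin_monad m2 n2) :
    lin_monad (m1 + m2)%N (n1 + n2)%N :=
  fm_bilin (fun f g => lprod f g) u1 u2.

Variable Z : zero_object C.

Fact dom_diag n (k : 'I_n) : (k + 1 + (n - k.+1) = n)%N.
Proof. by rewrite addn1 subnKC. Qed.
Fact cod_diag n (k : 'I_n) : (k + 2 + (n - k.+1) = n.+1)%N.
Proof. by rewrite addn2 addSn subnKC. Qed.
Fact dom_left n (k : 'I_n) : (k.+1 + 0 + (n - k.+1) = n)%N.
Proof. by rewrite addn0 subnKC. Qed.
Fact cod_left n (k : 'I_n) : (k.+1 + 1 + (n - k.+1) = n.+1)%N.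
Proof. by rewrite addn1 addSn subnKC. Qed.
Fact dom_right n (k : 'I_n) : (k + 0 + (n - k) = n)%N.
Proof. by rewrite addn0 subnKC // ltnW. Qed.
Fact cod_right n (k : 'I_n) : (k + 1 + (n - k) = n.+1)%N.
Proof. by rewrite addn1 addSn subnKC // ltnW. Qed.

(* The index [k] counts from 0. *)
Definition reduced_diag n (k : 'I_n) : lin_monad n.+1 n :=
  lin_of (lcast (dom_diag k) (cod_diag k)
    (lprod (lprod (lid C k) (ldiag C)) (lid C (n - k.+1))))
  - lin_of (lcast (dom_left k) (cod_left k)
      (lprod (lprod (lid C k.+1) (lzero Z 1)) (lid C (n - k.+1))))
  - lin_of (lcast (dom_right k) (cod_right k)
      (lprod (lprod (lid C k) (lzero Z 1)) (lid C (n - k)))).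

Inductive reduced_diag_family : forall m n, lin_monad m n -> Prop :=
| ReducedDiag n (k : 'I_n) : reduced_diag_family (reduced_diag k).

Definition primitivity_ideal : left_ideal lin_monad :=
  gen_left_ideal reduced_diag_family.

Definition Phi : monad R nat := eigenmonad primitivity_ideal.

Definition Phi_class m n (u : lin_monad m n)
    (Iu : u \in idealizer primitivity_ideal m n) : monad_cat Phi n m :=
  eigen_class Iu.
End Linearization.

(* Main.v *)
(* The morphisms with components projections or zero are encoded by maps between
   index sets; every structural map of the PROP is of this kind. A reduced
   diagonal times an identity is again a reduced diagonal, which gives
   I x L <= I, L x I <= I and the stability of the idealizer under x, so that
   x passes to classes. A permutation turns one reduced diagonal into another
   and hence lies in the idealizer.

   For the vanishing, let n < m and let e_i : m -> m kill the i-th coordinate.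
   If u is in the idealizer, then e_i u is in I, since e_i is, up to sign, a
   left multiple of a reduced diagonal; so u is congruent to the product of
   the 1 - e_i applied to u. For a morphism h = (h_1, ..., h_m) of m functions
   of n variables, regard the mn occurrences of variables as distinct. Modulo
   I, a variable with two occurrences or more can be split, as
   f(x, x) = f(x, 0) + f(0, x), until at most n < m occurrences are left. Then
   some component has none and is zero, and the product of the 1 - e_i kills
   the morphism. *)
Require Import Defs.
From HB Require Import structures.
From mathcomp Require Import all_boot all_algebra zify.
From mathcomp Require Import boolp.

Set Implicit Arguments.
Unset Strict Implicit.
Unset Printing Implicit Defensive.

Import GRing.Theory.
Local Open Scope ring_scope.

(** * Binary products in a Lawvere theory *)

Section Products.
Variable C : lawvere.

Lemma lpair_ext l m n (f g : C l (m + n)%N) :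
  lcomp (lpi1 C m n) f = lcomp (lpi1 C m n) g ->
  lcomp (lpi2 C m n) f = lcomp (lpi2 C m n) g -> f = g.
Proof. by move=> e1 e2; rewrite (lpair_uniq e1 e2); apply/esym/lpair_uniq. Qed.

Lemma lpi1_prod m1 n1 m2 n2 (f : C m1 n1) (g : C m2 n2) :
  lcomp (lpi1 C n1 n2) (lprod f g) = lcomp f (lpi1 C m1 m2).
Proof. exact: lpi1_pair. Qed.

Lemma lpi2_prod m1 n1 m2 n2 (f : C m1 n1) (g : C m2 n2) :
  lcomp (lpi2 C n1 n2) (lprod f g) = lcomp g (lpi2 C m1 m2).
Proof. exact: lpi2_pair. Qed.

Lemma lprod_comp l1 m1 n1 l2 m2 n2 (g1 : C m1 n1) (f1 : C l1 m1)
    (g2 : C m2 n2) (f2 : C l2 m2) :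
  lprod (lcomp g1 f1) (lcomp g2 f2) = lcomp (lprod g1 g2) (lprod f1 f2).
Proof.
by apply: lpair_ext; rewrite lcompA ?lpi1_prod ?lpi2_prod -!lcompA
  ?lpi1_prod ?lpi2_prod.
Qed.

Lemma lprod_id m n : lprod (lid C m) (lid C n) = lid C (m + n)%N.
Proof.
by apply: lpair_ext; rewrite ?lpi1_prod ?lpi2_prod lcomp1l lcomp1r.
Qed.

Lemma lsym_nat m1 n1 m2 n2 (f : C m1 n1) (g : C m2 n2) :
  lcomp (lsym C n1 n2) (lprod f g) = lcomp (lprod g f) (lsym C m1 m2).
Proof.
apply: lpair_ext; rewrite !lcompA.
  by rewrite lpi1_pair lpi1_prod lpi2_prod -lcompA lpi1_pair.
by rewrite lpi2_pair lpi2_prod lpi1_prod -lcompA lpi2_pair.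
Qed.

Lemma lsymK m n : lcomp (lsym C n m) (lsym C m n) = lid C (m + n)%N.
Proof.
apply: lpair_ext; rewrite lcompA lcomp1r.
  by rewrite lpi1_pair lpi2_pair.
by rewrite lpi2_pair lpi1_pair.
Qed.

Lemma ltuple_comp l m n (f : 'I_n -> C m 1%N) (g : C l m) :
  lcomp (ltuple f) g = ltuple (fun k => lcomp (f k) g).
Proof. by apply: ltuple_uniq => k; rewrite lcompA lproj_tuple. Qed.

Lemma eq_ltuple m n (f g : 'I_n -> C m 1%N) : f =1 g -> ltuple f = ltuple g.
Proof. by move=> fg; apply: ltuple_uniq => k; rewrite lproj_tuple. Qed.

Lemma lcast_compr l l' m n (em : l = l') (f : C m n) (g : C l m) :
  lcast em erefl (lcomp f g) = lcomp f (lcast em erefl g).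
Proof. by case: _ / em. Qed.

Lemma lcomp_cast k l l' m m' (el : l = l') (em : m = m') (f : C m' k)
    (g : C l m) :
  lcomp f (lcast el em g) = lcast el erefl (lcomp (lcast (esym em) erefl f) g).
Proof. by case: _ / el; case: _ / em f. Qed.

End Products.

(** * Morphisms given by index maps, and the strict symmetric monoidal axioms in [C] *)

Section StructuralMorphisms.
Variables (C : lawvere) (Z : zero_object C).

Definition zmor n : C n 1%N := lcomp (lzero Z 1) (lterm C n).

Lemma zmor_comp m n (f : C m n) : lcomp (zmor n) f = zmor m.
Proof. by rewrite /zmor -lcompA; congr lcomp; apply: lterm_uniq. Qed.

(** A tuple of zero morphisms factors through the object [0]; hence so does its composite with [f],
    and [0] is initial. *)
Lemma comp_ltuple_zmor l m (f : C m 1%N) :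
  lcomp f (ltuple (fun=> zmor l)) = zmor l.
Proof.
have -> : ltuple (fun=> zmor l) = lcomp (lzero Z m) (lterm C l).
  apply/esym/ltuple_uniq => k; rewrite lcompA; congr lcomp; exact: lzero_uniq.
by rewrite lcompA; congr lcomp; apply: lzero_uniq.
Qed.

(** Indices are plain natural numbers rather than ordinals, so that transport along an equality of
    objects leaves the index map unchanged (see [smor_cast]). *)
Definition oproj n (o : option nat) : C n 1%N :=
  oapp (lproj C) (zmor n) (obind insub o).

(* The morphism with components [x_(phi 0), ..., x_(phi (m - 1))], where
   [None] and out-of-range values stand for the zero morphism. *)
Definition smor n m (phi : nat -> option nat) : C n m :=
  ltuple (fun j : 'I_m => oproj n (phi j)).

Lemma oproj_ord n (i : 'I_n) : oproj n (Some (val i)) = lproj C i.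
Proof. by rewrite /oproj /= valK. Qed.

Lemma eq_smor n m phi psi :
  (forall j, (j < m)%N -> phi j = psi j) -> smor n m phi = smor n m psi.
Proof. by move=> e; apply: eq_ltuple => j; rewrite e. Qed.

(** The range condition matters: an index [i >= m] gives zero on the left, whereas [psi i] may be a
    valid index. *)
Lemma oproj_comp m n psi o : oapp (fun i => i < m)%N true o ->
  lcomp (oproj m o) (smor n m psi) = oproj n (obind psi o).
Proof.
case: o => [i|_] /=; last exact: zmor_comp.
by move=> lim; rewrite {1}/oproj /= insubT /= lproj_tuple.
Qed.

Lemma smor_comp l m n phi psi :
  (forall j, (j < l)%N -> oapp (fun i => i < m)%N true (phi j)) ->
  lcomp (smor m l phi) (smor n m psi) = smor n l (fun j => obind psi (phi j)).
Proof.
by move=> h; rewrite /smor ltuple_comp; apply: eq_ltuple => j;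
  rewrite oproj_comp ?h.
Qed.

Lemma smor_cast n n' m m' (en : n = n') (em : m = m') phi :
  lcast en em (smor n m phi) = smor n' m' phi.
Proof. by case: _ / en; case: _ / em. Qed.

Lemma smor_id n : lid C n = smor n n Some.
Proof. by apply: ltuple_uniq => k; rewrite lcomp1r oproj_ord. Qed.

Lemma smor_pi1 m n : lpi1 C m n = smor (m + n) m Some.
Proof. by apply: eq_ltuple => k; rewrite -oproj_ord. Qed.

Lemma smor_pi2 m n : lpi2 C m n = smor (m + n) n (fun j => Some (m + j)%N).
Proof. by apply: eq_ltuple => k; rewrite -oproj_ord. Qed.

Lemma smor_zero n : lzero Z n = smor 0 n (fun=> None).
Proof. by apply/esym/lzero_uniq. Qed.

Lemma smor_diag : ldiag C = smor 1 2 (fun=> Some 0%N).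
Proof.
apply: (@lpair_ext _ _ 1 1); rewrite ?lpi1_pair ?lpi2_pair ?smor_pi1 ?smor_pi2.
all: rewrite smor_comp ?smor_id => [|[]//].
all: by apply: eq_smor; case.
Qed.

Lemma smor_sym m n : lsym C m n =
  smor (m + n) (n + m) (fun j => Some (if j < n then m + j else j - n)%N).
Proof.
apply: lpair_ext; rewrite ?lpi1_pair ?lpi2_pair ?smor_pi1 ?smor_pi2 smor_comp.
all: try by move=> j /= ?; lia.
all: by apply: eq_smor => j ? /=; congr Some; case: ifP; lia.
Qed.

Lemma smor_prod m1 n1 m2 n2 phi psi :
  (forall j, (j < n1)%N -> oapp (fun i => i < m1)%N true (phi j)) ->
  (forall j, (j < n2)%N -> oapp (fun i => i < m2)%N true (psi j)) ->
  lprod (smor m1 n1 phi) (smor m2 n2 psi) =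
  smor (m1 + m2) (n1 + n2) (fun j =>
    if (j < n1)%N then phi j else omap (addn m1) (psi (j - n1)%N)).
Proof.
move=> hphi hpsi; apply: lpair_ext.
  rewrite lpi1_prod !smor_pi1 !smor_comp //=; last by move=> j ?; lia.
  by apply: eq_smor => j lj; rewrite lj; case: (phi j).
rewrite lpi2_prod !smor_pi2 !smor_comp //=; last by move=> j ?; lia.
apply: eq_smor => j lj; rewrite ltnNge leq_addr /= addKn.
by case: (psi j).
Qed.

(** The two sides are compared on the three factors. The transport is moved onto the projections,
    which are structural, and there [smor_cast] removes it. *)
Lemma lprodA m1 n1 m2 n2 m3 n3 (f : C m1 n1) (g : C m2 n2) (h : C m3 n3) :
  lcast (addnA m1 m2 m3) (addnA n1 n2 n3) (lprod f (lprod g h))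
    = lprod (lprod f g) h.
Proof.
apply: lpair_ext; rewrite lcomp_cast; last first.
  have -> : lcast (esym (addnA n1 n2 n3)) erefl (lpi2 C (n1 + n2) n3) =
      lcomp (lpi2 C n2 n3) (lpi2 C n1 (n2 + n3)).
    rewrite !smor_pi2 smor_cast smor_comp => [|j]; last by rewrite /= ltn_add2l.
    by apply: eq_smor => j _ /=; rewrite addnA.
  rewrite -!lcompA !lpi2_prod lcompA lpi2_prod -lcompA lcast_compr; congr lcomp.
  rewrite !smor_pi2 smor_comp => [|j]; last by rewrite /= ltn_add2l.
  by rewrite smor_cast; apply: eq_smor => j _ /=; rewrite addnA.
apply: lpair_ext; rewrite lpi1_prod -lcast_compr [in LHS]lcompA [in RHS]lcompA.
  have -> : lcomp (lpi1 C n1 n2)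
      (lcast (esym (addnA n1 n2 n3)) erefl (lpi1 C (n1 + n2) n3)) =
      lpi1 C n1 (n2 + n3).
    by rewrite !smor_pi1 smor_cast smor_comp // => j /=; lia.
  rewrite !lpi1_prod lcast_compr -lcompA; congr lcomp.
  by rewrite !smor_pi1 smor_cast smor_comp // => j /=; lia.
have -> : lcomp (lpi2 C n1 n2)
    (lcast (esym (addnA n1 n2 n3)) erefl (lpi1 C (n1 + n2) n3)) =
    lcomp (lpi1 C n2 n3) (lpi2 C n1 (n2 + n3)).
  by rewrite !smor_pi1 !smor_pi2 smor_cast !smor_comp // => j /=; lia.
rewrite -lcompA !lpi2_prod lcompA lpi1_prod lcast_compr -!lcompA; congr lcomp.
rewrite !smor_pi1 !smor_pi2 smor_cast.
by rewrite !smor_comp // => j /=; lia.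
Qed.

Lemma lprod0l m n (f : C m n) : lprod (lid C 0) f = f.
Proof.
apply: (@lpair_ext _ _ 0 n); first exact: lterm_uniq.
rewrite lpi2_prod.
have e k : lpi2 C 0 k = lid C k by rewrite smor_pi2 smor_id.
by rewrite !e lcomp1l lcomp1r.
Qed.

Lemma lprod0r m n (f : C m n) :
  lcast (addn0 m) (addn0 n) (lprod f (lid C 0)) = f.
Proof.
have lpi1_cast k : lcast (addn0 k) erefl (lpi1 C k 0) = lid C k.
  by rewrite smor_pi1 smor_id smor_cast.
rewrite -[LHS]lcomp1l lcomp_cast.
have -> : lcast (esym (addn0 n)) erefl (lid C n) = lpi1 C n 0.
  by rewrite smor_pi1 smor_id smor_cast.
by rewrite lpi1_prod lcast_compr lpi1_cast lcomp1r.
Qed.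

Lemma lsym0 n : lcast (addn0 n) (erefl n) (lsym C n 0) = lid C n.
Proof.
rewrite smor_sym smor_id smor_cast; apply: eq_smor => j _ /=.
by rewrite subn0.
Qed.

Lemma lsym_hexagon l m n :
  lcast (addnA l m n) (esym (addnA m n l)) (lsym C l (m + n)%N)
    = lcomp (lprod (lid C m) (lsym C l n))
        (lcast (erefl (l + m + n)%N) (esym (addnA m l n))
           (lprod (lsym C l m) (lid C n))).
Proof.
rewrite !smor_sym !smor_id !smor_prod.
all: try by move=> j /= lj; try case: ifP; lia.
rewrite !smor_cast smor_comp => [|j lj /=]; last by repeat case: ifP => /=; lia.
(* What remains is an equality of index maps, checked on the blocks of sizes [m], [n] and [l]. *)
apply: eq_smor => j lj /=.
case: (ltnP j m) => ? /=; last case: (ltnP (j - m) n) => ? /=.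
all: by repeat (case: ifP => ? /=); congr Some; lia.
Qed.

End StructuralMorphisms.

(** The elements satisfying [P] form a left ideal that contains [G], and the generated ideal is the
    intersection of all such ideals. *)
Lemma gen_left_ideal_ind (R : pzRingType) (X : Type) (T : monad R X)
    (G P : forall Y W, T Y W -> Prop) :
  (forall Y W, P Y W 0) ->
  (forall Y W a u v, P Y W u -> P Y W v -> P Y W (a *: u + v)) ->
  (forall Z Y W (g : T Z Y) u, P Y W u -> P Z W (mcomp g u)) ->
  (forall Y W u, G Y W u -> P Y W u) ->
  forall Y W u, u \in gen_left_ideal G Y W -> P Y W u.
Proof.
move=> P0 PD PM PG.
pose p Y W : {pred T Y W} := [pred u | `[< P Y W u >]].
have pc Y W : submod_closed (p Y W).
  by split=> [|a u v /asboolP Pu /asboolP Pv]; apply/asboolP; [|apply: PD].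
pose S Y W : submodClosed (T Y W) := HB.pack_for (submodClosed (T Y W)) (p Y W)
  (GRing.isSubmodClosed.Build R (T Y W) (p Y W) (pc Y W)).
have SM Z Y W (g : T Z Y) (f : T Y W) : f \in S Y W -> mcomp g f \in S Z W.
  by move=> /asboolP Pf; apply/asboolP/PM.
move=> Y W u /asboolP/(_ (LeftIdeal SM)) Su; apply/asboolP/Su => Y' W' v Gv.
exact/asboolP/PG.
Qed.

(** * The product extended bilinearly to the linearization *)

Section Tensor.
Variables (R : comPzRingType) (C : lawvere).
Implicit Types (l m n : nat).
Notation L := (lin_monad R C).

Lemma lin_ext (V : lmodType R) m n (f g : L m n -> V) : linear f -> linear g ->
  (forall h, f (lin_of R h) = g (lin_of R h)) -> f =1 g.
Proof. exact: fm_ext. Qed.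

Lemma lin_of_comp l m n (g : C m n) (f : C l m) :
  mcomp (lin_of R g : L n m) (lin_of R f : L m l) = lin_of R (lcomp g f).
Proof. exact: fm_bilinE. Qed.

Lemma lin_of_prod m1 n1 m2 n2 (f : C m1 n1) (g : C m2 n2) :
  lin_prod (lin_of R f) (lin_of R g) = lin_of R (lprod f g).
Proof. exact: fm_bilinE. Qed.

Lemma lin_prodDl m1 n1 m2 n2 (v : L m2 n2) :
  linear (fun u : L m1 n1 => lin_prod u v).
Proof. exact: fm_bilinDl. Qed.

Lemma lin_prodDr m1 n1 m2 n2 (u : L m1 n1) :
  linear (fun v : L m2 n2 => lin_prod u v).
Proof. exact: fm_bilinDr. Qed.

Lemma lin_prod0l m1 n1 m2 n2 (v : L m2 n2) : lin_prod (0 : L m1 n1) v = 0.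
Proof.
by have := lin_prodDl v (-1) (0 : L m1 n1) 0; rewrite scaler0 addr0 scaleN1r addNr.
Qed.

Lemma lin_prod0r m1 n1 m2 n2 (u : L m1 n1) : lin_prod u (0 : L m2 n2) = 0.
Proof.
by have := lin_prodDr u (-1) (0 : L m2 n2) 0; rewrite scaler0 addr0 scaleN1r addNr.
Qed.

Lemma lin_prodBl m1 n1 m2 n2 (u u' : L m1 n1) (v : L m2 n2) :
  lin_prod (u - u') v = lin_prod u v - lin_prod u' v.
Proof. by rewrite -scaleN1r addrC lin_prodDl scaleN1r addrC. Qed.

Lemma lin_prodBr m1 n1 m2 n2 (u : L m1 n1) (v v' : L m2 n2) :
  lin_prod u (v - v') = lin_prod u v - lin_prod u v'.
Proof. by rewrite -scaleN1r addrC lin_prodDr scaleN1r addrC. Qed.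

Lemma lin_prod_comp l1 m1 n1 l2 m2 n2 (g1 : L l1 m1) (f1 : L m1 n1)
    (g2 : L l2 m2) (f2 : L m2 n2) :
  lin_prod (mcomp g1 f1) (mcomp g2 f2) =
  mcomp (lin_prod g1 g2) (lin_prod f1 f2).
Proof.
(* Both sides are linear in each of the four variables, which are replaced by basis elements one
   after the other. *)
move: g1; apply: lin_ext => [a u v|a u v|g1].
- by rewrite mcompDl lin_prodDl.
- by rewrite lin_prodDl mcompDl.
move: f1; apply: lin_ext => [a u v|a u v|f1].
- by rewrite mcompDr lin_prodDl.
- by rewrite lin_prodDl mcompDr.
move: g2; apply: lin_ext => [a u v|a u v|g2].
- by rewrite mcompDl lin_prodDr.
- by rewrite lin_prodDr mcompDl.
move: f2; apply: lin_ext => [a u v|a u v|f2].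
- by rewrite mcompDr lin_prodDr.
- by rewrite lin_prodDr mcompDr.
by rewrite !(lin_of_comp, lin_of_prod) lprod_comp.
Qed.

Lemma lin_prod_id m n :
  lin_prod (munit L m) (munit L n) = munit L (m + n)%N.
Proof. by rewrite lin_of_prod lprod_id. Qed.

Lemma lin_sym_nat m1 n1 m2 n2 (u : L n1 m1) (v : L n2 m2) :
  mcomp (lin_of R (lsym C n1 n2) : L _ _) (lin_prod u v) =
  mcomp (lin_prod v u) (lin_of R (lsym C m1 m2) : L _ _).
Proof.
move: u; apply: lin_ext => [a u w|a u w|u].
- by rewrite lin_prodDl mcompDr.
- by rewrite lin_prodDr mcompDl.
move: v; apply: lin_ext => [a v w|a v w|v].
- by rewrite lin_prodDr mcompDr.
- by rewrite lin_prodDl mcompDl.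
by rewrite !(lin_of_comp, lin_of_prod) lsym_nat.
Qed.

Notation A := (monad_cat L).

Lemma kcastP (B : lincat R nat) m m' n n' (em : m = m') (en : n = n') :
  linear (@kcast _ B _ _ _ _ em en).
Proof. by case: _ / em; case: _ / en. Qed.

Lemma kcast_lin_of m m' n n' (em : m = m') (en : n = n') (f : C m n) :
  kcast (A := A) em en (lin_of R f) = lin_of R (lcast em en f).
Proof. by case: _ / em; case: _ / en. Qed.

Lemma lin_prodA (Z : zero_object C) m1 n1 m2 n2 m3 n3
    (u : L n1 m1) (v : L n2 m2) (w : L n3 m3) :
  kcast (A := A) (addnA m1 m2 m3) (addnA n1 n2 n3) (lin_prod u (lin_prod v w))
    = lin_prod (lin_prod u v) w.
Proof.
move: u; apply: lin_ext => [a u x|a u x|u].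
- by rewrite lin_prodDl kcastP.
- by rewrite !lin_prodDl.
move: v; apply: lin_ext => [a v x|a v x|v].
- by rewrite lin_prodDl lin_prodDr kcastP.
- by rewrite lin_prodDr lin_prodDl.
move: w; apply: lin_ext => [a w x|a w x|w].
- by rewrite !lin_prodDr kcastP.
- by rewrite !lin_prodDr.
by rewrite !lin_of_prod kcast_lin_of lprodA.
Qed.

Lemma lin_prod_unitl (Z : zero_object C) m n (u : L n m) :
  lin_prod (munit L 0) u = u.
Proof.
move: u; apply: lin_ext => [||u]; [exact: lin_prodDr | by [] |].
by rewrite lin_of_prod lprod0l.
Qed.

Lemma lin_prod_unitr (Z : zero_object C) m n (u : L n m) :
  kcast (A := A) (addn0 m) (addn0 n) (lin_prod u (munit L 0)) = u.
Proof.
move: u; apply: lin_ext => [a u v| |u]; [|by []|].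
- by rewrite lin_prodDl kcastP.
by rewrite lin_of_prod kcast_lin_of lprod0r.
Qed.
End Tensor.

(* [x_k] is doubled by [dup k], and a zero is inserted before [x_h] by [ins h]. *)
Definition dup (k j : nat) : option nat := Some (if (j <= k)%N then j else j.-1).
Definition ins (h j : nat) : option nat :=
  if (j < h)%N then Some j else if j == h then None else Some j.-1.

(** * The primitivity ideal, its idealizer and products *)

Section Primitivity.
Variables (R : comPzRingType) (C : lawvere) (Z : zero_object C).
Implicit Types (l m n k : nat).
Notation L := (lin_monad R C).
Notation I := (primitivity_ideal R Z).
Notation smor := (smor Z).

Lemma eq_lin_of3 m n (f f' g g' h h' : C n m) : f = f' -> g = g' -> h = h' ->
  lin_of R f - lin_of R g - lin_of R h =
  lin_of R f' - lin_of R g' - lin_of R h'.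
Proof. by move=> -> -> ->. Qed.

(** In coordinates the transports disappear, and the two subtracted terms insert a zero just after
    and just before [x_k]. *)
Lemma reduced_diagE n (k : 'I_n) : reduced_diag R Z k =
  lin_of R (smor n n.+1 (dup k)) - lin_of R (smor n n.+1 (ins k.+1))
  - lin_of R (smor n n.+1 (ins k)).
Proof.
have lkn := ltn_ord k.
apply: eq_lin_of3.
all: rewrite (smor_diag Z) || rewrite (smor_zero Z).
all: rewrite !(smor_id Z) !smor_prod ?smor_cast.
all: try by move=> j /= ?; try case: ifP; rewrite /=; lia.
all: apply: eq_smor => j lj; rewrite /dup /ins /=.
all: by repeat (case: ifP => /= ?); try congr Some; lia || reflexivity.
Qed.

Lemma reduced_diag_prim n (k : 'I_n) : reduced_diag R Z k \in I n.+1 n.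
Proof. by apply/asboolP => J GJ; apply/GJ/ReducedDiag. Qed.

(** This is f(x, x) = f(x, 0) + f(0, x) modulo the ideal: in [Q] the two copies of [x_k] are
    independent variables, and the difference is [Q] composed with a reduced diagonal. *)
Lemma smor_split_prim n m k (A B D : C n m) (Q : C n.+1 m) : (k < n)%N ->
  A = lcomp Q (smor n n.+1 (dup k)) -> B = lcomp Q (smor n n.+1 (ins k.+1)) ->
  D = lcomp Q (smor n n.+1 (ins k)) ->
  lin_of R A - lin_of R B - lin_of R D \in I m n.
Proof.
move=> lkn -> -> ->; rewrite -!lin_of_comp -!mcompBr.
have /= <- := reduced_diagE (Ordinal lkn).
apply: (lidealM (l := I)); exact: reduced_diag_prim.
Qed.

Lemma prim_ind (P : forall m n, L m n -> Prop) :
  (forall m n, P m n 0) ->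
  (forall m n a u v, P m n u -> P m n v -> P m n (a *: u + v)) ->
  (forall l m n (g : L l m) u, P m n u -> P l n (mcomp g u)) ->
  (forall n (k : 'I_n), P n.+1 n (reduced_diag R Z k)) ->
  forall m n u, u \in I m n -> P m n u.
Proof.
by move=> P0 PD PM PG; apply: gen_left_ideal_ind => // m n u [].
Qed.

(** The [g] for which [mcomp g u] is in the ideal form a left ideal, so it suffices to test the
    generators. *)
Lemma prim_idealizerP m n (u : L m n) :
  (forall k : 'I_m, mcomp (reduced_diag R Z k) u \in I m.+1 n) ->
  u \in idealizer I m n.
Proof.
move=> h; apply/idealizerP => l g Ig; move: Ig u h.
move: l m g; apply: prim_ind => [l m|l m a u v hu hv|l p m g u hu|p k] w h.
- by rewrite mcomp0l rpred0.
- by rewrite mcompDl rpredD ?rpredZ ?hu ?hv.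
- by rewrite -mcompA lidealM ?hu.
- exact: h.
Qed.

(** Doubling coordinate [k] after the map amounts to doubling the variable [s k] before it, because
    by injectivity no other coordinate uses that variable. *)
Lemma smor_inj_idealizer m n (s : nat -> nat) :
  (forall j, (j < m)%N -> (s j < n)%N) ->
  {in gtn m &, injective s} ->
  lin_of R (smor n m (fun j => Some (s j))) \in idealizer I m n.
Proof.
move=> ls inj_s; apply: prim_idealizerP => k; have lkm := ltn_ord k.
rewrite reduced_diagE !mcompBl !lin_of_comp !smor_comp.
all: try by move=> j /= ?; rewrite /ins /=; repeat case: ifP => /= ?; lia.
have sk (j : nat) : (j < m)%N -> j <> k :> nat -> s j <> s k.
  by move=> lj njk /inj_s; rewrite !inE => /(_ lj lkm).
(* The copies at [k] and [k + 1] go to [s k] and [s k + 1]; elsewhere [q] follows [s] and skips the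
   index added after [s k]. *)
pose q (j : nat) := if j == k :> nat then s k else if j == k.+1 then (s k).+1 else
  let i := s (if (j < k)%N then j else j.-1) in if (i < s k)%N then i else i.+1.
have lq j : (j < m.+1)%N -> (q j < n.+1)%N.
  move=> lj; rewrite /q; have := ls k lkm; have := ls j.-1; have := ls j.
  by repeat case: ifP => /= ?; lia.
apply: (@smor_split_prim _ _ (s k) _ _ _
  (smor n.+1 m.+1 (fun j => Some (q j)))); first exact: ls.
all: rewrite smor_comp //; apply: eq_smor => j lj; rewrite /q /dup /ins /=.
all: case: (ltngtP j k) => [ljk|lkj|ejk]; [| |subst j]; rewrite /= ?ltnn ?leqnn ?eqxx //=.
all: try (have [ejk|njk] := eqVneq j k.+1; [subst j|]; try by lia).
all: rewrite /= ?ltnn ?leqnn ?eqxx ?ltnSn //=.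
all: try (case: (ltngtP (s j) (s k)) => [?|?|/sk]; try by lia).
all: try (case: (ltngtP (s j.-1) (s k)) => [?|?|/sk]; try by lia).
all: repeat (case: ifP => /= ?) => //; try congr Some; try by lia.
Qed.

(** The factor [v] is placed so that an ideal element acts first: (g u) x v = (g x id)(u x v), and
    for a generator D, D x v = (id x v)(D x id). *)
Lemma prim_prodl m1 n1 m2 n2 (u : L m1 n1) (v : L m2 n2) :
  u \in I m1 n1 -> lin_prod u v \in I (m1 + m2)%N (n1 + n2)%N.
Proof.
move: m1 n1 u; apply: prim_ind => [m n|m n a u w hu hw|l m n g u hu|n k].
- by rewrite lin_prod0l rpred0.
- by rewrite lin_prodDl; apply: rpredD (rpredZ a hu) hw.
- by rewrite -[v]mcomp1l lin_prod_comp lidealM.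
rewrite -[reduced_diag R Z k]mcomp1l -[v]mcomp1r lin_prod_comp.
apply: (lidealM (l := I)).
have lkn := ltn_ord k; rewrite reduced_diagE !lin_prodBl !lin_of_prod.
apply: (@smor_split_prim _ _ k _ _ _ (smor _ _ Some)); first by lia.
all: rewrite (smor_id Z) smor_prod ?smor_comp //.
all: try by move=> j /= ?; rewrite /ins; repeat case: ifP => /= ?; lia.
all: apply: eq_smor => j lj; rewrite /dup /ins /=.
all: by repeat (case: ifP => /= ?); try congr Some; lia || reflexivity.
Qed.

Lemma prim_prodr m1 n1 m2 n2 (u : L m1 n1) (v : L m2 n2) :
  v \in I m2 n2 -> lin_prod u v \in I (m1 + m2)%N (n1 + n2)%N.
Proof.
move: m2 n2 v; apply: prim_ind => [m n|m n a v w hv hw|l m n g v hv|n k].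
- by rewrite lin_prod0r rpred0.
- by rewrite lin_prodDr; apply: rpredD (rpredZ a hv) hw.
- by rewrite -[u]mcomp1l lin_prod_comp lidealM.
rewrite -[reduced_diag R Z k]mcomp1l -[u]mcomp1r lin_prod_comp.
apply: (lidealM (l := I)).
have lkn := ltn_ord k; rewrite reduced_diagE !lin_prodBr !lin_of_prod.
(* The map [smor _ _ Some] replaces the transport from [(n1 + n).+1] to [n1 + n.+1]; the doubled
   variable now comes after the [n1] variables of [u]. *)
apply: (@smor_split_prim _ _ (n1 + k) _ _ _ (smor _ _ Some)); first by lia.
all: rewrite (smor_id Z) smor_prod ?smor_comp //.
all: try by move=> j /= ?; rewrite /ins; repeat case: ifP => /= ?; lia.
all: apply: eq_smor => j lj; rewrite /dup /ins /=.
all: by repeat (case: ifP => /= ?); try congr Some; lia || reflexivity.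
Qed.

(** A reduced diagonal on [m1 + m2] acts on one factor only, on [u] if [k < m1] and on [v]
    otherwise; that factor lands in the ideal, and the product with the other one stays there. *)
Lemma prim_prod_idealizer m1 n1 m2 n2 (u : L m1 n1) (v : L m2 n2) :
  u \in idealizer I m1 n1 -> v \in idealizer I m2 n2 ->
  lin_prod u v \in idealizer I (m1 + m2)%N (n1 + n2)%N.
Proof.
move=> /idealizerP Iu /idealizerP Iv; apply: prim_idealizerP => k.
have lk := ltn_ord k; case: (ltnP k m1) => lkm.
  have -> : reduced_diag R Z k =
      lin_prod (reduced_diag R Z (Ordinal lkm)) (munit L m2).
  { rewrite !reduced_diagE !lin_prodBl !lin_of_prod (smor_id Z) !smor_prod.
    all: try by move=> j /= ?; rewrite /ins; repeat case: ifP => /= ?; lia.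
    apply: eq_lin_of3.
    all: apply: eq_smor => j lj; rewrite /dup /ins /=.
    all: by repeat (case: ifP => /= ?); try congr Some; lia || reflexivity. }
  have := prim_prodl (mcomp (munit L m2) v) (Iu _ _ (reduced_diag_prim (Ordinal lkm))).
  by rewrite lin_prod_comp.
have lkm2 : (k - m1 < m2)%N by lia.
have -> : reduced_diag R Z k = mcomp (lin_of R (smor _ _ Some) : L _ _)
    (lin_prod (munit L m1) (reduced_diag R Z (Ordinal lkm2))).
{ rewrite !reduced_diagE !lin_prodBr !lin_of_prod (smor_id Z) !smor_prod.
  all: try by move=> j /= ?; rewrite /ins; repeat case: ifP => /= ?; lia.
  rewrite !mcompBr !lin_of_comp !smor_comp.
  all: try by move=> j /= ?; lia.
  apply: eq_lin_of3.
  all: apply: eq_smor => j lj; rewrite /dup /ins /=.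
  all: by repeat (case: ifP => /= ?); try congr Some; lia || reflexivity. }
rewrite -mcompA -lin_prod_comp; apply: (lidealM (l := I)).
by apply: prim_prodr; apply/Iv/reduced_diag_prim.
Qed.

Lemma lsym_idealizer m n :
  lin_of R (lsym C m n) \in idealizer I (n + m)%N (m + n)%N.
Proof.
rewrite (smor_sym Z); apply: smor_inj_idealizer => [j|i j].
  by case: ifP; lia.
by rewrite !inE; do 2 case: ifP; lia.
Qed.

End Primitivity.

(** * Vanishing of the classes when [n < m] *)

Section Vanishing.
Variables (R : comPzRingType) (C : lawvere) (Z : zero_object C).
Implicit Types (l m n : nat).
Notation L := (lin_monad R C).
Notation I := (primitivity_ideal R Z).
Notation smor := (smor Z).
Notation zmor := (zmor Z).

Definition kill m i : L m m :=
  lin_of R (smor m m (fun j => if j == i then None else Some j)).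

Lemma idealizer_kill m n i (u : L m n) : (i < m)%N ->
  u \in idealizer I m n -> mcomp (kill m i) u \in I m n.
Proof.
(* [f] forgets the coordinates [i] and [i + 1] and puts a zero at place [i]. All three terms of the
   reduced diagonal then become [kill m i], with signs +, -, -. *)
move=> lim /idealizerP Iu; pose f : L m m.+1 := lin_of R
  (smor m.+1 m (fun j => if j == i then None
                         else Some (if (j < i)%N then j else j.+1))).
have e : mcomp f (reduced_diag R Z (Ordinal lim)) = - kill m i.
{ rewrite reduced_diagE !mcompBr !lin_of_comp !smor_comp; last first.
  all: try by move=> j ?; repeat (case: ifP => //= ?); lia.
  rewrite -[RHS]add0r -(subrr (kill m i)) /kill.
  apply: eq_lin_of3.
  all: apply: eq_smor => j lj; rewrite /dup /ins /=; case: (ltngtP j i) => //= ?.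
  all: by repeat (case: ifP => /= ?); try congr Some; lia || reflexivity. }
have -> : mcomp (kill m i) u = - mcomp f (mcomp (reduced_diag R Z (Ordinal lim)) u).
  by rewrite mcompA e -[- kill m i]sub0r mcompBl mcomp0l sub0r opprK.
rewrite rpredN; apply: (lidealM (l := I)); apply: Iu.
exact: reduced_diag_prim.
Qed.

Lemma kill_comm m i k : mcomp (kill m i) (kill m k) = mcomp (kill m k) (kill m i).
Proof.
rewrite !lin_of_comp !smor_comp.
all: try by move=> j ?; repeat (case: ifP => //= ?); lia.
congr lin_of; apply: eq_smor => j lj.
by repeat (case: ifP => /= ?); try congr Some; lia || reflexivity.
Qed.

(* The product of the commuting idempotents [1 - kill m i], for [i] in [s]. *)
Definition cross m n (s : seq nat) (u : L m n) : L m n :=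
  foldr (fun i w => w - mcomp (kill m i) w) u s.

Lemma cross_cons m n i s (u : L m n) :
  cross (i :: s) u = cross s u - mcomp (kill m i) (cross s u).
Proof. by []. Qed.

Lemma cross_linear m n s : linear (@cross m n s).
Proof.
move=> a u v; elim: s => // i s IHs; rewrite !cross_cons IHs.
by rewrite mcompDr scalerBr opprD addrACA.
Qed.

Lemma cross_prim m n s (u : L m n) : u \in I m n -> cross s u \in I m n.
Proof.
move=> Iu; elim: s => // i s IHs; rewrite cross_cons.
by apply: rpredB => //; apply: (lidealM (l := I)).
Qed.

Lemma cross_idealizer m n s (u : L m n) : {in s, forall i, (i < m)%N} ->
  u \in idealizer I m n -> cross s u - u \in I m n.
Proof.
move=> ls Iu; elim: s ls => [|i s IHs] ls; first by rewrite subrr rpred0.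
have /IHs Is : {in s, forall i, (i < m)%N}.
  by move=> k ks; rewrite ls // inE ks orbT.
rewrite cross_cons; set w := cross s u in Is *.
(* Here [kill m i] applied to [w] is split over [w - u], in the ideal by induction, and [u], treated
   by [idealizer_kill]. *)
have -> : w - mcomp (kill m i) w - u =
    (w - u) - mcomp (kill m i) (w - u) - mcomp (kill m i) u.
  rewrite mcompBr opprB addrA [RHS]addrAC addrK.
  by rewrite addrAC.
apply: rpredB; last by apply: idealizer_kill; rewrite ?ls ?inE ?eqxx.
by apply: rpredB => //; apply: (lidealM (l := I)).
Qed.

Lemma cross_kill m n s i (u : L m n) :
  mcomp (kill m i) (cross s u) = cross s (mcomp (kill m i) u).
Proof.
elim: s => // k s IHs; rewrite !cross_cons -IHs.
by rewrite mcompBr mcompA kill_comm -mcompA.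
Qed.

(** The factor [1 - kill m i] annihilates [u] and commutes with the other factors. *)
Lemma cross_eq0 m n s i (u : L m n) :
  mcomp (kill m i) u = u -> i \in s -> cross s u = 0.
Proof.
move=> iu; elim: s => // k s IHs; rewrite inE cross_cons.
case/predU1P=> [<-|/IHs ->]; first by rewrite cross_kill iu subrr.
by rewrite mcomp0r subrr.
Qed.

(* Each component [h_i] of [h] gets its own copies [(i, k)] of the variables
   [x_k]; those outside [A] are set to zero. *)
Definition restrict m n (h : C n m) (A : {set 'I_m * 'I_n}) : C n m :=
  ltuple (fun i => lcomp (lcomp (lproj C i) h)
    (ltuple (fun k => if (i, k) \in A then lproj C k else zmor n))).

Lemma restrictT m n (h : C n m) : restrict h setT = h.
Proof.
apply/esym/ltuple_uniq => i; rewrite -[LHS]lcomp1r; congr lcomp.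
by apply: ltuple_uniq => k; rewrite inE lcomp1r.
Qed.

Lemma restrict_split m n (h : C n m) (A : {set 'I_m * 'I_n}) a : a \in A ->
  lin_of R (restrict h A) - lin_of R (restrict h (A :\ a))
  - lin_of R (restrict h [set b in A | (b == a) || (b.2 != a.2)]) \in I m n.
Proof.
move=> Aa; have lk := ltn_ord a.2.
(* The occurrence [a] gets a fresh variable at index [a.2 + 1], and later variables move up. Setting
   the fresh variable to zero removes [a]; setting the old one to zero removes the other occurrences
   of that variable. *)
pose q (b : 'I_m * 'I_n) : nat :=
  if b == a then a.2.+1 else if (b.2 <= a.2)%N then b.2 : nat else b.2.+1.
have lq b : (q b < n.+1)%N.
  by rewrite /q; have := ltn_ord b.2; repeat (case: ifP => ?); lia.
pose Q : C n.+1 m := ltuple (fun i => lcomp (lcomp (lproj C i) h)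
  (ltuple (fun k => oproj Z n.+1 (if (i, k) \in A then Some (q (i, k)) else None)))).
have QE phi : lcomp Q (smor n n.+1 phi) =
    ltuple (fun i => lcomp (lcomp (lproj C i) h)
  (ltuple (fun k => oproj Z n (if (i, k) \in A then phi (q (i, k)) else None)))).
  rewrite /Q ltuple_comp; apply: eq_ltuple => i; rewrite -lcompA; congr lcomp.
  rewrite ltuple_comp; apply: eq_ltuple => k; rewrite oproj_comp; last first.
    by case: ifP => //= _; apply: lq.
  by case: ifP.
apply: (@smor_split_prim R C Z n m a.2 _ _ _ Q) => //.
all: rewrite QE; apply: eq_ltuple => i; congr lcomp; apply: eq_ltuple => k.
all: rewrite -(oproj_ord Z) ?inE -[zmor n]/(oproj Z n None) -fun_if.
all: congr oproj; rewrite /q /dup /ins /=.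
all: have eka : (i, k) == a -> k = a.2 :> nat by move/eqP=> <-.
all: rewrite -?val_eqE /=; case: ((i, k) \in A) => //=.
all: case: ((i, k) == a) eka => /= [/(_ isT) eka|_]; try rewrite eka.
all: rewrite ?ltnn ?leqnn ?eqxx //=; try case: (ltngtP k a.2) => //= ?.
all: by repeat (case: ifP => /= ?); try congr Some; lia || reflexivity.
Qed.

Lemma cross_restrict m n (h : C n m) (A : {set 'I_m * 'I_n}) : (n < m)%N ->
  cross (iota 0 m) (lin_of R (restrict h A) : L m n) \in I m n.
Proof.
move=> ltnm; have [N] := ubnP #|A|; elim: N A => // N IHN A; rewrite ltnS => ltAN.
have [/existsP[i /forallP Ai]|] := boolP [exists i, [forall k, (i, k) \notin A]].
  (* Component [i] has no occurrence left, hence is zero, and [kill m i] fixes the morphism. *)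
  rewrite (@cross_eq0 _ _ _ i) ?rpred0 //; last by rewrite mem_iota /=.
  rewrite lin_of_comp; congr lin_of; apply: lhom_ext => j.
  rewrite lcompA !lproj_tuple.
  rewrite val_eqE; have [->|_] := eqVneq j i; rewrite /=.
    rewrite -[oproj Z m None]/(zmor m) zmor_comp.
    have -> : (fun k => if (i, k) \in A then lproj C k else zmor n) = fun=> zmor n.
      by apply/funext => k; rewrite (negbTE (Ai k)).
    by rewrite comp_ltuple_zmor.
  by rewrite oproj_ord lproj_tuple.
rewrite negb_exists => /forallP Afull.
(* If no variable occurs twice, then [#|A| <= n]; but every component has an occurrence, so
   [m <= #|A|], against [n < m]. *)
have [/dinjectiveP/card_in_imset injA|] := boolP (dinjectiveb (fun b => b.2) A).
  have leAn : (#|A| <= n)%N by rewrite -injA (leq_trans (max_card _)) ?card_ord.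
  have : (#|[set b.1 | b in A]| <= #|A|)%N by apply: leq_imset_card.
  suff -> : [set b.1 | b in A] = setT by 
    by rewrite cardsT card_ord => /leq_trans/(_ leAn); rewrite leqNgt ltnm.
  apply/setP=> i; rewrite inE; have := Afull i.
  rewrite negb_forall => /existsP[k]; rewrite negbK => Aik.
  by apply/imsetP; exists (i, k).
case/dinjectivePn => a Aa [b /andP[nba Ab] /= eab].
set A1 := A :\ a.
set A2 := [set b in A | (b == a) || (b.2 != a.2)].
(* The coefficients [1] give the sum the shape required by [cross_linear]. *)
have e (V : lmodType R) (x y z : V) : x = 1 *: (x - y - z) + (1 *: y + z).
  by rewrite !scale1r -(addrA x) -opprD subrK.
rewrite [X in cross _ X](e _ _ (lin_of R (restrict h A1)) (lin_of R (restrict h A2))).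
rewrite !cross_linear !scale1r.
(* Both sets are smaller: [A1] lacks [a], and [A2] lacks [b], which shares its variable with [a]. *)
have lt1 : (#|A1| < N)%N.
  by apply: leq_trans ltAN; apply/proper_card/properD1.
have lt2 : (#|A2| < N)%N.
  apply: leq_trans ltAN; apply: proper_card; apply/properP; split.
    by apply/subsetP => c; rewrite inE => /andP[].
  by exists b; rewrite // !inE (negbTE nba) -eab eqxx andbF.
apply: rpredD; first by apply: cross_prim; apply: restrict_split.
by apply: rpredD; apply: IHN.
Qed.

Lemma idealizer_subset_prim m n (u : L m n) : (n < m)%N ->
  u \in idealizer I m n -> u \in I m n.
Proof.
(* [u] is its [cross] minus an element of the ideal, and by linearity [cross] need only be examined
   on basis morphisms. *)
move=> ltnm Iu; rewrite -[u](subKr (cross (iota 0 m) u)).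
apply: rpredB; last first.
  by apply: cross_idealizer => // i; rewrite mem_iota.
rewrite [u]fm_decomp; elim/big_rec: _ => [|h w _ Iw].
  by apply: cross_prim; apply: rpred0.
rewrite cross_linear; apply: rpredD => //; apply: rpredZ.
by rewrite -[h]restrictT; apply: cross_restrict.
Qed.
End Vanishing.

(** * The PROP structure on the eigenmonad *)

Section PhiProp.
Variables (R : comPzRingType) (C : lawvere) (Z : zero_object C).
Implicit Types (l m n : nat).
Notation L := (lin_monad R C).
Notation I := (primitivity_ideal R Z).
Notation PhiC := (monad_cat (Phi R Z)).

Definition Phi_tens m1 n1 m2 n2 (x : PhiC m1 n1) (y : PhiC m2 n2) :
    PhiC (m1 + m2)%N (n1 + n2)%N :=
  Phi_class (prim_prod_idealizer (subquot_reprP x) (subquot_reprP y)).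

(** Independence of representatives: u' x v' - u x v = (u' - u) x v' + u x (v' - v), and the ideal
    absorbs products on both sides. *)
Lemma Phi_tensE m1 n1 m2 n2 (u : L n1 m1) (v : L n2 m2)
    (Iu : u \in idealizer I n1 m1) (Iv : v \in idealizer I n2 m2) :
  Phi_tens (Phi_class Iu) (Phi_class Iv) =
  Phi_class (prim_prod_idealizer Iu Iv).
Proof.
apply/eigen_classP; set u' := subquot_repr _; set v' := subquot_repr _.
have -> : lin_prod u' v' - lin_prod u v =
    lin_prod (u' - u) v' + lin_prod u (v' - v).
  by rewrite lin_prodBl lin_prodBr addrA subrK.
by apply: rpredD; [apply: prim_prodl | apply: prim_prodr];
  apply: subquot_classK.
Qed.

Lemma Phi_ind m n (P : PhiC m n -> Prop) :
  (forall (u : L n m) (Iu : u \in idealizer I n m), P (Phi_class Iu)) ->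
  forall x, P x.
Proof. exact: eigen_ind. Qed.

Lemma Phi_class_eq m n (u v : L n m) (Iu : u \in idealizer I n m)
    (Iv : v \in idealizer I n m) : u = v -> Phi_class Iu = Phi_class Iv.
Proof. exact: eigen_class_eq. Qed.

Lemma Phi_classL m n a (u v : L n m) (Iu : u \in idealizer I n m)
    (Iv : v \in idealizer I n m) (Iauv : a *: u + v \in idealizer I n m) :
  a *: Phi_class Iu + Phi_class Iv = Phi_class Iauv.
Proof. exact/esym/eigen_classL. Qed.

Lemma Phi_compE l m n (v : L n m) (u : L m l) (Iv : v \in idealizer I n m)
    (Iu : u \in idealizer I m l) :
  kcomp (Phi_class Iv) (Phi_class Iu) = Phi_class (idealizerM Iv Iu).
Proof. exact: eigen_compE. Qed.

Lemma Phi_idE n : kid PhiC n = Phi_class (idealizer_unit I n).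
Proof. by []. Qed.

(** A class carries a membership proof; the existential avoids describing how this proof is
    transported. *)
Lemma Phi_kcast m m' n n' (em : m = m') (en : n = n') (u : L n m)
    (Iu : u \in idealizer I n m) :
  exists Iu' : kcast (A := monad_cat L) em en u \in idealizer I n' m',
    kcast (A := PhiC) em en (Phi_class Iu) = Phi_class Iu'.
Proof. by case: _ / em; case: _ / en; exists Iu. Qed.

Lemma Phi_tensDl m1 n1 m2 n2 (y : PhiC m2 n2) :
  linear (fun x : PhiC m1 n1 => Phi_tens x y).
Proof.
move=> a; elim/Phi_ind=> u Iu; elim/Phi_ind=> v Iv.
elim/Phi_ind: y => w Iw; have Iauv := rpredD (rpredZ a Iu) Iv.
rewrite (Phi_classL Iu Iv Iauv).
rewrite !Phi_tensE.
have [Iuw Ivw] := (prim_prod_idealizer Iu Iw, prim_prod_idealizer Iv Iw).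
have Iauvw := rpredD (rpredZ a Iuw) Ivw.
rewrite (Phi_classL _ _ Iauvw).
by apply: Phi_class_eq; rewrite lin_prodDl.
Qed.

Lemma Phi_tensDr m1 n1 m2 n2 (x : PhiC m1 n1) :
  linear (fun y : PhiC m2 n2 => Phi_tens x y).
Proof.
move=> a; elim/Phi_ind=> u Iu; elim/Phi_ind=> v Iv.
elim/Phi_ind: x => w Iw; have Iauv := rpredD (rpredZ a Iu) Iv.
rewrite (Phi_classL Iu Iv Iauv).
rewrite !Phi_tensE.
have [Iwu Iwv] := (prim_prod_idealizer Iw Iu, prim_prod_idealizer Iw Iv).
have Iwauv := rpredD (rpredZ a Iwu) Iwv.
rewrite (Phi_classL _ _ Iwauv).
by apply: Phi_class_eq; rewrite lin_prodDr.
Qed.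

Definition Phi_sym m n : PhiC (m + n)%N (n + m)%N :=
  Phi_class (lsym_idealizer R Z m n).

(** Each axiom is checked on representatives. The definition is transparent so that its tensor and
    symmetry compute to [Phi_tens] and [Phi_sym]. *)
Definition Phi_prop : prop_structure PhiC.
Proof.
exists Phi_tens Phi_sym.
- exact: Phi_tensDl.
- exact: Phi_tensDr.
- move=> m n; rewrite !Phi_idE Phi_tensE.
  by apply: Phi_class_eq; apply: lin_prod_id.
- move=> l1 m1 n1 l2 m2 n2 + + + +.
  elim/Phi_ind=> g1 Ig1; elim/Phi_ind=> f1 If1.
  elim/Phi_ind=> g2 Ig2; elim/Phi_ind=> f2 If2.
  rewrite (Phi_compE Ig1 If1) (Phi_compE Ig2 If2) !Phi_tensE Phi_compE.
  by apply: Phi_class_eq; rewrite lin_prod_comp.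
- move=> m1 n1 m2 n2 m3 n3; elim/Phi_ind=> f If; elim/Phi_ind=> g Ig.
  elim/Phi_ind=> h Ih; rewrite !Phi_tensE.
  have [Iu ->] := Phi_kcast (addnA m1 m2 m3) (addnA n1 n2 n3)
    (prim_prod_idealizer If (prim_prod_idealizer Ig Ih)).
  by apply: Phi_class_eq; apply: lin_prodA.
- move=> m n; elim/Phi_ind=> f If.
  rewrite Phi_idE Phi_tensE.
  by apply: Phi_class_eq; apply: lin_prod_unitl.
- move=> m n; elim/Phi_ind=> f If.
  rewrite Phi_idE Phi_tensE.
  have [Iu ->] := Phi_kcast (addn0 m) (addn0 n)
    (prim_prod_idealizer If (idealizer_unit I 0)).
  by apply: Phi_class_eq; apply: lin_prod_unitr.
- move=> m1 n1 m2 n2; elim/Phi_ind=> f If; elim/Phi_ind=> g Ig.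
  rewrite !Phi_tensE !Phi_compE.
  by apply: Phi_class_eq; apply: lin_sym_nat.
- move=> m n; rewrite Phi_compE Phi_idE; apply: Phi_class_eq.
  by rewrite lin_of_comp lsymK.
- move=> n; have [Iu ->] := Phi_kcast (addn0 n) (erefl n) (lsym_idealizer R Z n 0).
  by rewrite Phi_idE; apply: Phi_class_eq; rewrite kcast_lin_of lsym0.
- move=> l m n.
  have [Iu ->] := Phi_kcast (addnA l m n) (esym (addnA m n l))
    (lsym_idealizer R Z l (m + n)).
  rewrite !Phi_tensE.
  have [Iv ->] := Phi_kcast (erefl (l + m + n)%N) (esym (addnA m l n))
    (prim_prod_idealizer (lsym_idealizer R Z l m) (idealizer_unit I n)).
  rewrite Phi_compE; apply: Phi_class_eq.
  rewrite !lin_of_prod !kcast_lin_of lin_of_comp.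
  by rewrite lsym_hexagon.
Defined.
Lemma Phi_class_eq0 m n (u : L n m) (Iu : u \in idealizer I n m) :
  u \in I n m -> Phi_class Iu = 0.
Proof.
move=> Pu; have I0 : 0 \in idealizer I n m by apply: rpred0.
have -> : 0 = Phi_class I0.
  rewrite -[LHS](addNr (Phi_class I0)) -scaleN1r.
  have I00 : -1 *: 0 + 0 \in idealizer I n m by rewrite scaler0 addr0.
  by rewrite (Phi_classL I0 I0 I00); apply: Phi_class_eq; rewrite scaler0 addr0.
by apply/eigen_classP; rewrite subr0.
Qed.
End PhiProp.

Theorem theorem1 (R : comPzRingType) (C : lawvere) (Z : zero_object C) :
  (exists P : prop_structure (monad_cat (Phi R Z)),
     (forall (m1 n1 m2 n2 : nat)
         (u1 : lin_monad R C n1 m1) (u2 : lin_monad R C n2 m2)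
         (I1 : u1 \in idealizer (primitivity_ideal R Z) n1 m1)
         (I2 : u2 \in idealizer (primitivity_ideal R Z) n2 m2),
       exists I12 : lin_prod u1 u2
           \in idealizer (primitivity_ideal R Z) (n1 + n2)%N (m1 + m2)%N,
         ptens P (Phi_class I1) (Phi_class I2) = Phi_class I12)
     /\ (forall m n : nat,
       exists Is : lin_of R (lsym C m n)
           \in idealizer (primitivity_ideal R Z) (n + m)%N (m + n)%N,
         psym P m n = Phi_class Is))
  /\ (forall M : monoid_object C, monoid_generated M ->
       forall n m : nat, (n < m)%N ->
       forall x : monad_cat (Phi R Z) n m, x = 0%R).
Proof.
split=> [|_ _ n m ltnm]; last first.
  elim/Phi_ind=> u Iu; exact/Phi_class_eq0/idealizer_subset_prim.
exists (Phi_prop R Z); split=> [m1 n1 m2 n2 u1 u2 I1 I2|m n].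
  by exists (prim_prod_idealizer I1 I2); apply: Phi_tensE.
by exists (lsym_idealizer R Z m n).
Qed.
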